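(* Let $n\ge1$ and $k\ge1$ be integers. Let $f\colon\{-1,1\}^n\to\mathbb{R}$ satisfy $\mathbb{E}[fW_S]=0$ for all $S\subseteq\{1,\ldots,n\}$ with $|S|<k$. Then $$\mathbb{E}f^2\ \le\ \frac3k\sum_{i=1}^n\frac{\mathbb{E}(D_if)^2}{\max\left(1,\ \log\left(\|D_if\|_2/\|D_if\|_{1+e^{-2/k}}\right)\right)}\ \le\ 8\sum_{i=1}^n\frac{\mathbb{E}(D_if)^2}{k+\log\left(\|D_if\|_2/\|D_if\|_1\right)} .$$
   Context: $\{-1,1\}^n$ carries the uniform probability measure, $\mathbb{E}$ is expectation with respect to it, and $\|g\|_p=(\mathbb{E}|g|^p)^{1/p}$. $W_S(x)=\prod_{i\in S}x_i$ for $S\subseteq\{1,\ldots,n\}$. For $i=1,\ldots,n$, $D_if(x)=\frac12\left[f(x_1,\ldots,x_n)-f(x_1,\ldots,x_{i-1},-x_i,x_{i+1},\ldots,x_n)\right]$. Convention: terms of the sums with $D_if\equiv0$ are interpreted as $0$. *)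

(* Defs.v *)
From mathcomp Require Import all_boot all_order all_algebra.
From mathcomp Require Import reals sequences exp.

Set Implicit Arguments.
Unset Strict Implicit.
Unset Printing Implicit Defensive.

Import Order.TTheory GRing.Theory Num.Theory.
Local Open Scope ring_scope.

(* The discrete cube {-1,1}^n, encoded by bits: [false] stands for 1 and
   [true] for -1, see [cube_coord]. *)
Definition cube (n : nat) := {ffun 'I_n -> bool}.

Definition cube_coord (R : realType) (n : nat) (x : cube n) (i : 'I_n) : R :=
  (-1) ^+ x i.

Definition flip (n : nat) (i : 'I_n) (x : cube n) : cube n :=
  [ffun j => if j == i then ~~ x j else x j].

Definition expect (R : realType) (n : nat) (g : cube n -> R) : R :=
  (\sum_(x : cube n) g x) / #|{: cube n}|%:R.

Definition pnorm (R : realType) (n : nat) (p : R) (g : cube n -> R) : R :=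
  (expect (fun x => `|g x| `^ p)) `^ p^-1.

Definition walsh (R : realType) (n : nat) (S : {set 'I_n}) (x : cube n) : R :=
  \prod_(i in S) cube_coord R x i.

Definition discrete_deriv (R : realType) (n : nat) (i : 'I_n)
    (f : cube n -> R) (x : cube n) : R :=
  2^-1 * (f x - f (flip i x)).

Definition not_identically_zero (R : realType) (n : nat) (g : cube n -> R) : bool :=
  [exists x : cube n, g x != 0].

(* Main.v *)
Require Import Defs.
From mathcomp Require Import all_boot all_order all_algebra.
From mathcomp Require Import reals sequences exp.
From mathcomp Require Import boolp normedtype derive realfun ring lra.

(** Let [T_t W_S = e^{-t|S|} W_S] be the heat semigroup and [T = 1/k]. Since
    [f] has no coefficients below level [k],
    [(1 - e^{-2}) E f^2 <= E f^2 - E (T_T f)^2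
       = sum_i 2 \int_0^T E (T_t D_i f)^2 dt].
    Hypercontractivity bounds [||T_t g||_2] by [||g||_p] with [p = 1 + e^{-2t}],
    and log-convexity of the norms between [q = 1 + e^{-2T}] and [2] makes this
    at most [||g||_2 e^{-(t/T)L/2}] where [L = log (||g||_2 / ||g||_q)];
    integrating in [t] gives the factor [1 / max 1 L]. The integral only ever
    enters through left Riemann sums with [m >= 4L] steps, so no integration is
    needed. The second inequality follows from log-convexity between [1] and [2].

    Hypercontractivity is proved by adding one coordinate at a time: writing
    [g = g_0 + g_1] with [g_0] even and [g_1] odd in that coordinate, the
    induction hypothesis applies to both parts, and reverse Minkowski in
    [L^{p/2}] followed by the pointwise two-point inequality recombines them. *)

Set Implicit Arguments.
Unset Strict Implicit.
Unset Printing Implicit Defensive.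

Import Order.TTheory GRing.Theory Num.Theory numFieldNormedType.Exports.
Local Open Scope ring_scope.

(** * Real inequalities *)

Section RealInequalities.
Variable R : realType.
Implicit Types a b p r s x y : R.

Lemma powR_le_tangent x a : 0 <= x -> 0 < a <= 1 -> x `^ a <= 1 + a * (x - 1).
Proof.
rewrite le_eqVlt => /predU1P[<-|x0] /andP[a0 a1].
  by rewrite powR0 ?gt_eqF//; nra.
have y0 : 0 < 1 + a * (x - 1) by nra.
have lnD (z : R) : 0 < z -> ln z <= z - 1.
  by move=> z0; rewrite -[in leLHS](subrKC 1 z) le_ln1Dx; lra.
(* With Y = 1 + a(x - 1), the bound ln z <= z - 1 at z = x/Y and at z = 1/Y, taken with weights [a]
   and [1 - a], has right side (ax + 1 - a)/Y - 1 = 0. *)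
have := lnD (x / (1 + a * (x - 1))) (divr_gt0 x0 y0).
have := lnD (1 + a * (x - 1))^-1; rewrite invr_gt0 => /(_ y0).
rewrite ln_div ?posrE// lnV ?posrE//.
set l := ln (1 + _); set i := (1 + _)^-1 => h1 h2.
have iE : (1 + a * (x - 1)) * i = 1 by rewrite divff ?gt_eqF.
rewrite -[leRHS]lnK ?posrE// -[leLHS]lnK ?posrE ?powR_gt0// ler_expR ln_powR.
rewrite -/l; nra.
Qed.

Lemma powR_ge_tangent x a : 0 < x -> a <= 0 -> 1 + a * (x - 1) <= x `^ a.
Proof.
move=> x0 a0; rewrite /powR gt_eqF//.
apply: le_trans (expR_ge1Dx _).
have : ln x <= x - 1 by rewrite -[in leLHS](subrKC 1 x) le_ln1Dx; lra.
by nra.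
Qed.

Lemma weighted_AMGM x y a : 0 <= x -> 0 <= y -> 0 <= a <= 1 ->
  x `^ a * y `^ (1 - a) <= a * x + (1 - a) * y.
Proof.
move=> x0; rewrite le_eqVlt => /predU1P[<-|y0] /andP[a0 a1].
  have [->|a1'] := eqVneq a 1; first by rewrite subrr powRr0 powRr1//; lra.
  by rewrite powR0 ?mulr0 ?subr_eq0 1?eq_sym//; nra.
have [->|a0'] := eqVneq a 0.
  by rewrite powRr0 subr0 powRr1 ?(ltW y0)//; lra.
rewrite powRB ?(gt_eqF y0) ?implybT// powRr1 ?(ltW y0)//.
have xy0 : 0 <= x / y by rewrite divr_ge0// ltW.
have : 0 < a <= 1 by rewrite lt_def a0' a0.
move=> /(powR_le_tangent xy0) h.
have e : x `^ a = (x / y) `^ a * y `^ a.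
  by rewrite -powRM ?(ltW y0)// divfK ?(gt_eqF y0).
rewrite e mulrACA divff ?(gt_eqF (powR_gt0 _ y0))// mulr1 mulrC.
have -> : a * x + (1 - a) * y = y * (1 + a * (x / y - 1)).
  by field; rewrite (gt_eqF y0).
by rewrite ler_pM2l.
Qed.

Lemma is_derive_powR_shift s x (e : bool) : 0 < 1 + (-1) ^+ e * x ->
  is_derive x 1 (fun y => (1 + (-1) ^+ e * y) `^ s)
    (s * (1 + (-1) ^+ e * x) `^ (s - 1) * (-1) ^+ e).
Proof.
move=> h.
have d1 : is_derive x 1 (fun y : R => 1 + (-1) ^+ e * y) ((-1) ^+ e).
  apply: is_derive_eq.
  by rewrite add0r mul1r /GRing.scale/= mulr1.
exact: (@is_derive1_comp R (fun y => y `^ s) _ x _ _ (is_derive1_powR s h) d1).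
Qed.

Lemma ge0_of_is_derive (f df : R -> R) x : 0 <= x -> f 0 = 0 ->
  (forall y, 0 <= y <= x -> is_derive y 1 f (df y)) ->
  (forall y, 0 <= y <= x -> 0 <= df y) -> 0 <= f x.
Proof.
move=> x0 f0 fdf df0.
have [y||c] := @MVT_segment R f df 0 x x0.
- by rewrite in_itv/= => /andP[y0 yx]; apply: fdf; rewrite !ltW.
- apply: derivable_within_continuous => y; rewrite in_itv/= => yx.
  by have [] := fdf y yx.
- by rewrite in_itv/= f0 !subr0 => cx ->; rewrite mulr_ge0// df0.
Qed.

(** Differentiating in [x] leaves (1 + x)^(s-1) + (1 - x)^(s-1) >= 2. Both powers lie above their
    tangents at 1, whose linear terms cancel. *)
Lemma powR_odd_part_ge s x : 0 < s <= 1 -> 0 <= x < 1 ->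
  2 * s * x <= (1 + x) `^ s - (1 - x) `^ s.
Proof.
move=> /andP[s0 s1] /andP[x0 x1].
pose f y : R := (1 + (-1) ^+ false * y) `^ s - (1 + (-1) ^+ true * y) `^ s
                - (2 * s) *: y.
pose df y : R := s * (1 + y) `^ (s - 1) + s * (1 - y) `^ (s - 1) - 2 * s.
suff : 0 <= f x by rewrite /f expr0 expr1 /GRing.scale/= mul1r mulN1r; lra.
apply: (@ge0_of_is_derive f df) => //.
- by rewrite /f !mulr0 addr0 subrr scaler0 subr0.
- move=> y /andP[y0 yx].
  have h0 : 0 < 1 + (-1) ^+ false * y by rewrite expr0; lra.
  have h1 : 0 < 1 + (-1) ^+ true * y by rewrite expr1; lra.
  have d0 := is_derive_powR_shift s h0.
  have d1 := is_derive_powR_shift s h1.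
  apply: is_derive_eq.
  by rewrite /df expr0 expr1 mul1r mulN1r /GRing.scale/=; lra.
- move=> y /andP[y0 yx]; rewrite /df.
  have h0 : 1 + (s - 1) * (1 + y - 1) <= (1 + y) `^ (s - 1).
    by apply: powR_ge_tangent; lra.
  have h1 : 1 + (s - 1) * (1 - y - 1) <= (1 - y) `^ (s - 1).
    by apply: powR_ge_tangent; lra.
  nra.
Qed.

(** One differentiation reduces this to the odd part with exponent [s = p - 1]. *)
Lemma powR_even_part_ge_lt1 p x : 1 < p <= 2 -> 0 <= x < 1 ->
  2 + p * (p - 1) * x ^+ 2 <= (1 + x) `^ p + (1 - x) `^ p.
Proof.
move=> /andP[p1 p2] /andP[x0 x1].
pose f y : R := (1 + (-1) ^+ false * y) `^ p + (1 + (-1) ^+ true * y) `^ p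
                - 2 - (p * (p - 1)) *: (y * y).
pose df y : R :=
  p * ((1 + y) `^ (p - 1) - (1 - y) `^ (p - 1) - 2 * (p - 1) * y).
suff : 0 <= f x by rewrite /f expr0 expr1 /GRing.scale/= mul1r mulN1r; lra.
apply: (@ge0_of_is_derive f df) => //.
- by rewrite /f !mulr0 addr0 powR1 scaler0; lra.
- move=> y /andP[y0 yx].
  have h0 : 0 < 1 + (-1) ^+ false * y by rewrite expr0; lra.
  have h1 : 0 < 1 + (-1) ^+ true * y by rewrite expr1; lra.
  have d0 := is_derive_powR_shift p h0.
  have d1 := is_derive_powR_shift p h1.
  apply: is_derive_eq.
  by rewrite /df expr0 expr1 mul1r mulN1r /GRing.scale/=; lra.
- move=> y /andP[y0 yx]; rewrite /df mulr_ge0 ?subr_ge0//; first lra.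
  by apply: powR_odd_part_ge; lra.
Qed.

Lemma powR_even_part_ge p x : 1 < p <= 2 -> 0 <= x <= 1 ->
  2 + p * (p - 1) * x ^+ 2 <= (1 + x) `^ p + (1 - x) `^ p.
Proof.
move=> p12 /andP[x0]; rewrite le_eqVlt => /predU1P[->|x1]; last first.
  by apply: powR_even_part_ge_lt1 => //; rewrite x0.
have /andP[p1 p2] := p12.
apply/ler_addgt0Pr => e e0.
(* The endpoint 1 is approached through [1 - d]: the quadratic term loses at most 4d and d^p <= d,
   an error of at most 5d <= e. *)
pose d := Num.min (e / 5) 1.
have d0 : 0 < d by rewrite lt_min ltr01 divr_gt0.
have d1 : d <= 1 by rewrite ge_min lexx orbT.
have de : 5 * d <= e by rewrite -ler_pdivlMl// mulrC ge_min lexx.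
have h : 0 <= 1 - d < 1 by lra.
have := powR_even_part_ge_lt1 p12 h.
have -> : 1 - (1 - d) = d by lra.
have : d `^ p <= d by rewrite ge1r_powR ?d0// ltW.
have : (1 + (1 - d)) `^ p <= (1 + 1) `^ p.
  by apply: ge0_ler_powR; rewrite ?nnegrE; lra.
have := powR_ge0 (1 - 1 : R) p.
have pp : p * (p - 1) <= 2 by nra.
have : p * (p - 1) * (2 * d) <= 4 * d.
  by rewrite mulrA ler_wpM2r ?(ltW d0)//; lra.
have : 0 <= p * (p - 1) * d ^+ 2 by rewrite !mulr_ge0 ?sqr_ge0//; lra.
nra.
Qed.

(** Bonami's two-point inequality, raised to the power [p]. By homogeneity a = 1 and b = c with |c|
    <= 1. The tangent bound for the power p/2 gives 1 + p(p - 1)c^2/2, which is half of the lower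
    bound for the even part. *)
Lemma two_point p a b : 1 < p <= 2 ->
  (a ^+ 2 + (p - 1) * b ^+ 2) `^ (p / 2)
    <= (`|a + b| `^ p + `|a - b| `^ p) / 2.
Proof.
move=> /andP[p1 p2].
(* As p - 1 <= 1, giving the weight [p - 1] to the smaller square only increases the left side; the
   right side is symmetric. *)
wlog ab : a b / `|b| <= `|a|.
  move=> H; have [/H//|/ltW ba] := lerP `|b| `|a|.
  apply: le_trans (_ : (b ^+ 2 + (p - 1) * a ^+ 2) `^ (p / 2) <= _).
    have h : a ^+ 2 <= b ^+ 2.
      rewrite -[a ^+ 2]real_normK ?num_real//.
      by rewrite -[b ^+ 2]real_normK ?num_real// lerXn2r.
    have := sqr_ge0 a; have := sqr_ge0 b.
    by move=> ? ?; apply: ge0_ler_powR; rewrite ?nnegrE; nra.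
  by have := H _ _ ba; rewrite (addrC b) (distrC b).
have [a0|a0] := eqVneq a 0.
  move: ab; rewrite a0 normr0 normr_le0 => /eqP ->.
  rewrite expr0n/= mulr0 !addr0 subr0 normr0 !powR0 ?addr0 ?mul0r// gt_eqF//; lra.
pose c := b / a.
have bE : b = c * a by rewrite divfK.
have c1 : `|c| <= 1 by rewrite normrM normfV ler_pdivrMr ?normr_gt0// mul1r.
have c1' := c1; move: c1'; rewrite ler_norml => /andP[c2 c3].
have -> : a ^+ 2 + (p - 1) * b ^+ 2 = `|a| ^+ 2 * (1 + (p - 1) * c ^+ 2).
  by rewrite real_normK ?num_real// bE; ring.
have -> : a + b = a * (1 + c) by rewrite bE; ring.
have -> : a - b = a * (1 - c) by rewrite bE; ring.
have c22 : 0 <= (p - 1) * c ^+ 2 by rewrite mulr_ge0 ?sqr_ge0//; lra.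
rewrite powRM ?exprn_ge0//; last lra.
rewrite -(@powR_mulrn _ `|a|)// -powRrM [2 * _]mulrC divfK ?pnatr_eq0//.
rewrite !normrM !powRM// -mulrDr -mulrA ler_pM2l ?powR_gt0 ?normr_gt0//.
apply: le_trans (_ : 1 + p / 2 * ((p - 1) * c ^+ 2) <= _).
  have := @powR_le_tangent (1 + (p - 1) * c ^+ 2) (p / 2).
  by rewrite addrAC subrr add0r; apply; lra.
have := @powR_even_part_ge p `|c|; rewrite p1 p2 c1 normr_ge0 => /(_ isT isT).
rewrite real_normK ?num_real//.
have [c0|c0] := leP 0 c.
  rewrite !ger0_norm; lra.
rewrite (ltr0_norm c0) opprK !ger0_norm; lra.
Qed.

(** This is concavity of z^r at the points x/l and y/(1 - l), whose mean with weights [l] and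
    [1 - l] is x + y. The weight stays free so that it can be chosen in the reverse Minkowski
    inequality. *)
Lemma powR_concave (r l x y : R) : 0 < r <= 1 -> 0 < l < 1 -> 0 <= x -> 0 <= y ->
  l `^ (1 - r) * x `^ r + (1 - l) `^ (1 - r) * y `^ r <= (x + y) `^ r.
Proof.
move=> r01 /andP[l0 l1] x0 y0.
have /andP[r0 r1] := r01.
have [s0|s0] := eqVneq (x + y) 0.
  have -> : x = 0 by lra.
  have -> : y = 0 by lra.
  by rewrite addr0 powR0 ?mulr0 ?addr0// gt_eqF.
have {}s0 : 0 < x + y by rewrite lt_def s0 addr_ge0.
have scale (m z : R) : 0 < m -> 0 <= z ->
    m `^ (1 - r) * z `^ r = m * (z / (m * (x + y))) `^ r * (x + y) `^ r.
  move=> m0 z0.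
  rewrite -mulrA -powRM ?divr_ge0// ?mulr_ge0 ?(ltW m0) ?(ltW s0)//.
  have -> : z / (m * (x + y)) * (x + y) = m^-1 * z.
    by field; rewrite !gt_eqF.
  rewrite powRM ?invr_ge0 ?(ltW m0)// mulrA; congr (_ * _).
  rewrite powRB ?(gt_eqF m0) ?implybT// powRr1 ?(ltW m0)//; congr (_ * _).
  by rewrite -(powR_inv1 (ltW m0)) -powRrM mulN1r powRN.
have m0 : 0 < 1 - l by lra.
rewrite !scale// -mulrDl ler_piMl ?powR_ge0//.
have q0 (m z : R) : 0 < m -> 0 <= z -> 0 <= z / (m * (x + y)).
  by move=> *; rewrite divr_ge0// mulr_ge0 ?(ltW s0) ?ltW.
have h1 := ler_wpM2l (ltW l0) (powR_le_tangent (q0 _ _ l0 x0) r01).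
have h2 := ler_wpM2l (ltW m0) (powR_le_tangent (q0 _ _ m0 y0) r01).
apply: le_trans (lerD h1 h2) _.
rewrite le_eqVlt; apply/orP; left; apply/eqP; field.
by rewrite !gt_eqF.
Qed.

Lemma expRN_concave (s t : R) : 0 < t -> 0 <= s <= 1 ->
  s * (1 - expR (- t)) <= 1 - expR (- (s * t)).
Proof.
move=> t0 /andP[s0 s1]; have [->|s'] := eqVneq s 0.
  by rewrite !mul0r oppr0 expR0 subrr.
have s01 : 0 < s <= 1 by rewrite lt_def s' s0.
have := powR_le_tangent (expR_ge0 (- t)) s01.
by rewrite -expRM mulNr [t * s]mulrC; lra.
Qed.

End RealInequalities.

(** * Positive functionals *)

Section PositiveFunctionals.
Variables (R : realType) (T : Type) (L : (T -> R) -> R).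

(** Stated abstractly in order to cover both [expect] and, at a fixed point, [cond_expect]. *)
Definition positive_functional :=
  (forall a b (F G : T -> R),
     L (fun x => a * F x + b * G x) = a * L F + b * L G) /\
  (forall F G : T -> R, (forall x, F x <= G x) -> L F <= L G).

Hypothesis posL : positive_functional.
Implicit Types F G g u v : T -> R.

Let L_lin : forall a b F G, L (fun x => a * F x + b * G x) = a * L F + b * L G
  := posL.1.
Let L_le : forall F G, (forall x, F x <= G x) -> L F <= L G := posL.2.

Lemma positive_functional_ge0 F : (forall x, 0 <= F x) -> 0 <= L F.
Proof.
move=> F0; have := L_lin 0 0 F F.
rewrite !mul0r addr0 => <-; apply: L_le => x.
by rewrite !mul0r addr0.
Qed.

(** Let A and B be the two terms on the left. Applying [L] to the pointwise concavity bound with l =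
    A/(A + B) gives the lower bound (A + B)^r. If A or B is 0, that weight is degenerate and
    monotonicity suffices. *)
Lemma reverse_Minkowski (r : R) F G : 0 < r <= 1 ->
  (forall x, 0 <= F x) -> (forall x, 0 <= G x) ->
  L (fun x => F x `^ r) `^ r^-1 + L (fun x => G x `^ r) `^ r^-1
    <= L (fun x => (F x + G x) `^ r) `^ r^-1.
Proof.
move=> r01 F0 G0; have /andP[r0 r1] := r01.
have rV0 : 0 <= r^-1 by rewrite invr_ge0 ltW.
have LF0 : 0 <= L (fun x => F x `^ r).
  by apply: positive_functional_ge0 => x; exact: powR_ge0.
have LG0 : 0 <= L (fun x => G x `^ r).
  by apply: positive_functional_ge0 => x; exact: powR_ge0.
have LFG0 : 0 <= L (fun x => (F x + G x) `^ r).
  by apply: positive_functional_ge0 => x; exact: powR_ge0.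
set A := L _ `^ _; set B := L (fun x => G x `^ r) `^ _.
have AE : L (fun x => F x `^ r) = A `^ r.
  by rewrite /A -powRrM mulVf ?(gt_eqF r0)// powRr1.
have BE : L (fun x => G x `^ r) = B `^ r.
  by rewrite /B -powRrM mulVf ?(gt_eqF r0)// powRr1.
have [A0|A0] := eqVneq A 0.
  rewrite A0 add0r; apply: ge0_ler_powR => //.
  apply: L_le => x; apply: ge0_ler_powR; rewrite ?nnegrE ?addr_ge0// ?(ltW r0)//.
  by rewrite lerDr.
have [B0|B0] := eqVneq B 0.
  rewrite B0 addr0; apply: ge0_ler_powR => //.
  apply: L_le => x; apply: ge0_ler_powR; rewrite ?nnegrE ?addr_ge0// ?(ltW r0)//.
  by rewrite lerDl.
have {}A0 : 0 < A by rewrite lt_def A0 powR_ge0.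
have {}B0 : 0 < B by rewrite lt_def B0 powR_ge0.
clearbody A B.
have AB0 : 0 < A + B by rewrite addr_gt0.
have l01 : 0 < A / (A + B) < 1.
  by rewrite divr_gt0//= ltr_pdivrMr// mul1r ltrDl.
have lE : 1 - A / (A + B) = B / (A + B) by field; rewrite gt_eqF.
have := L_le (fun x => powR_concave r01 l01 (F0 x) (G0 x)).
rewrite L_lin AE BE lE => h.
rewrite -[leLHS]powRr1 ?(ltW AB0)// -[X in _ `^ X](divff (lt0r_neq0 r0)).
rewrite powRrM; apply: ge0_ler_powR; rewrite ?nnegrE ?powR_ge0//.
apply: le_trans h.
have scale (x : R) : 0 < x ->
    (x / (A + B)) `^ (1 - r) * x `^ r = x * (A + B) `^ (r - 1).
  move=> x0; rewrite powRM ?invr_ge0 ?(ltW x0) ?(ltW AB0)//.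
  rewrite mulrAC -powRD ?(gt_eqF x0) ?implybT// subrK powRr1 ?(ltW x0)//.
  by rewrite -(powR_inv1 (ltW AB0)) -powRrM mulN1r opprB.
rewrite !scale// -mulrDl mulr_powRB1 ?(ltW AB0)//.
Qed.

Lemma Holder u v (a : R) : 0 <= a <= 1 ->
  (forall x, 0 <= u x) -> (forall x, 0 <= v x) -> 0 < L u -> 0 < L v ->
  L (fun x => u x `^ a * v x `^ (1 - a)) <= L u `^ a * L v `^ (1 - a).
Proof.
move=> a01 u0 v0 Lu0 Lv0.
(* Pointwise AM-GM is applied to [u / L u] and [v / L v] and scaled by [c]; applying [L] then gives
   c(a + 1 - a) = c. *)
pose c := L u `^ a * L v `^ (1 - a).
have c0 : 0 < c by rewrite mulr_gt0 ?powR_gt0.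
have H x : u x `^ a * v x `^ (1 - a)
    <= (c * a / L u) * u x + (c * (1 - a) / L v) * v x.
  have := @weighted_AMGM R (u x / L u) (v x / L v) a.
  rewrite !divr_ge0 ?(ltW Lu0) ?(ltW Lv0)// => /(_ isT isT a01).
  move=> /(ler_wpM2l (ltW c0)); rewrite [X in _ <= X -> _](_ : _ =
    (c * a / L u) * u x + (c * (1 - a) / L v) * v x); last by ring.
  congr (_ <= _); rewrite /c mulrACA -!powRM ?divr_ge0 ?(ltW Lu0) ?(ltW Lv0)//.
  by rewrite ![L _ * _]mulrC !divfK ?gt_eqF.
apply: le_trans (L_le H) _; rewrite L_lin -/c !divfK ?gt_eqF// -mulrDr.
by rewrite addrC subrK mulr1.
Qed.

(* Log-convexity of [p |-> L |g|^p]. *)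
Lemma Lyapunov g (p q1 q2 a : R) : 0 <= a <= 1 -> p != 0 ->
  p = a * q1 + (1 - a) * q2 ->
  0 < L (fun x => `|g x| `^ p) -> 0 < L (fun x => `|g x| `^ q1) ->
  0 < L (fun x => `|g x| `^ q2) ->
  ln (L (fun x => `|g x| `^ p))
    <= a * ln (L (fun x => `|g x| `^ q1))
       + (1 - a) * ln (L (fun x => `|g x| `^ q2)).
Proof.
move=> a01 p0 pE Lp L1 L2.
have := @Holder (fun x => `|g x| `^ q1) (fun x => `|g x| `^ q2) a a01 _ _ L1 L2.
have -> : (fun x => (`|g x| `^ q1) `^ a * (`|g x| `^ q2) `^ (1 - a)) =
          (fun x => `|g x| `^ p).
  apply/funext => x; rewrite -!powRrM -powRD.
    by rewrite pE mulrC [q2 * _]mulrC.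
  by apply/implyP; rewrite [q1 * _]mulrC [q2 * _]mulrC -pE (negPf p0).
move=> /(_ (fun=> powR_ge0 _ _) (fun=> powR_ge0 _ _)) h.
rewrite -!ln_powR -lnM ?posrE ?powR_gt0// ler_ln ?posrE// mulr_gt0 ?powR_gt0//.
Qed.
End PositiveFunctionals.

(** * Hypercontractivity on the cube *)

Lemma flipK n (i : 'I_n) : involutive (flip i).
Proof.
move=> x; apply/ffunP => j; rewrite !ffunE.
by case: eqP => // _; rewrite negbK.
Qed.

Lemma flipC n (i j : 'I_n) x : flip i (flip j x) = flip j (flip i x).
Proof. by apply/ffunP => l; rewrite !ffunE; do 2 case: eqP. Qed.

(** Induction on the Hamming distance between [x] and [y]: flipping a coordinate where they differ
    lowers it. *)
Lemma flip_invariant_constant n T (h : cube n -> T) :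
  (forall i x, h (flip i x) = h x) -> forall x y, h x = h y.
Proof.
move=> hf x y; have [m] := ubnP #|[set i | x i != y i]|.
elim: m x => // m IH x; rewrite ltnS => le_m.
have [D0|[i]] := set_0Vmem [set i | x i != y i].
  congr h; apply/ffunP => i.
  by have /setP/(_ i) := D0; rewrite !inE => /negbFE/eqP.
rewrite inE => xyi; rewrite -(hf i); apply: IH.
apply: leq_trans le_m; apply: proper_card; apply/properP; split.
  apply/subsetP => j; rewrite !inE ffunE; by case: (j =P i) => [->|//].
exists i; first by rewrite inE.
by rewrite inE ffunE eqxx; case: (x i) (y i) xyi => [] [].
Qed.

(** * Partial averages and noise operators *)

Section Noise.
Variables (R : realType) (n : nat).
Implicit Types (rho : R) (f g : cube n -> R) (J : seq 'I_n) (i : 'I_n) (x : cube n).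

(** The average over the coordinates in [J], kept as a function of the point so that the other
    coordinates act as parameters during induction on [J]. *)
Fixpoint cond_expect J g x : R :=
  if J is i :: J' then (cond_expect J' g x + cond_expect J' g (flip i x)) / 2
  else g x.

Definition even_part i g x : R := 2^-1 * (g x + g (flip i x)).

(** [discrete_deriv i g] is the part of [g] that is odd in coordinate [i]; the noise operator damps
    only this part. *)
Definition noise1 rho i g x := even_part i g x + rho * discrete_deriv i g x.

Fixpoint noise rho J g : cube n -> R :=
  if J is i :: J' then noise rho J' (noise1 rho i g) else g.

Lemma cond_expect_flip J i g x :
  cond_expect J (fun y => g (flip i y)) x = cond_expect J g (flip i x).
Proof. by elim: J x => //= j J IH x; rewrite !IH flipC. Qed.

Lemma cond_expect_positive J x :
  positive_functional (fun g => cond_expect J g x).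
Proof.
split=> [a b F G|F G FG]; elim: J x => //= i J IH x.
  by rewrite !IH; field.
by rewrite ler_pM2r ?invr_gt0// lerD.
Qed.

Lemma noise_flip rho J i g :
  noise rho J (fun y => g (flip i y)) = fun x => noise rho J g (flip i x).
Proof.
elim: J g => //= j J IH g; rewrite -IH; congr noise; apply/funext => x.
by rewrite /noise1 /even_part /discrete_deriv flipC.
Qed.

Lemma noise_lin rho J a b F G :
  noise rho J (fun x => a * F x + b * G x) =
  fun x => a * noise rho J F x + b * noise rho J G x.
Proof.
elim: J F G => //= j J IH F G; rewrite -IH; congr noise; apply/funext => x.
by rewrite /noise1 /even_part /discrete_deriv; ring.
Qed.

Lemma noise_hypercontractive rho J g x : 0 < rho <= 1 ->
  cond_expect J (fun y => noise rho J g y ^+ 2) x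
    <= cond_expect J (fun y => `|g y| `^ (1 + rho ^+ 2)) x
         `^ (2 / (1 + rho ^+ 2)).
Proof.
move=> /andP[r0 r1]; set p := 1 + rho ^+ 2.
have p1 : 1 < p by rewrite ltrDl exprn_gt0.
have p2 : p <= 2 by rewrite /p; nra.
have p0 : 0 < p by lra.
have rE : rho ^+ 2 = p - 1 by rewrite /p; ring.
elim: J g x => [|i J IH] g x /=.
  rewrite -powRrM mulrC divfK ?gt_eqF//.
  by rewrite powR_mulrn// real_normK ?num_real.
pose g0 := even_part i g; pose g1 := discrete_deriv i g.
pose u := noise rho J g0; pose v := noise rho J g1.
have nE : noise rho J (noise1 rho i g) = fun y => u y + rho * v y.
  rewrite -[RHS](_ : (fun y => 1 * u y + rho * v y) = _); last first.
    by apply/funext => y; rewrite mul1r.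
  rewrite -noise_lin; congr noise; apply/funext => y.
  by rewrite /noise1 mul1r.
(* The noise in [J] commutes with the flip, so [u] inherits the evenness of [g0] and [v] the oddness
   of [g1]. *)
have uE y : u (flip i y) = u y.
  rewrite -[LHS]/((fun x => noise rho J g0 (flip i x)) y) -noise_flip.
  congr (noise rho J _ y); apply/funext => z.
  by rewrite /g0 /even_part flipK addrC.
have vE y : v (flip i y) = - v y.
  rewrite -[LHS]/((fun x => noise rho J g1 (flip i x)) y) -noise_flip.
  transitivity (noise rho J (fun x => -1 * g1 x + 0 * g1 x) y).
    congr (noise rho J _ y); apply/funext => z.
    by rewrite /g1 /discrete_deriv flipK; ring.
  by rewrite noise_lin mul0r addr0 mulN1r.
have [lin mono] := cond_expect_positive J x.
(* Averaging (u + rho v)^2 and (u - rho v)^2 cancels the cross term. *)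
have -> : (cond_expect J (fun y => noise rho J (noise1 rho i g) y ^+ 2) x +
   cond_expect J (fun y => noise rho J (noise1 rho i g) y ^+ 2) (flip i x)) / 2 =
   cond_expect J (fun y => u y ^+ 2) x
     + rho ^+ 2 * cond_expect J (fun y => v y ^+ 2) x.
  rewrite -cond_expect_flip mulrDl mulrC [X in _ + X]mulrC -lin.
  rewrite -[X in X + _]mul1r -lin; congr (cond_expect J _ x).
  by apply/funext => y; rewrite nE uE vE; field.
have -> : (cond_expect J (fun y => `|g y| `^ p) x +
   cond_expect J (fun y => `|g y| `^ p) (flip i x)) / 2 =
   cond_expect J (fun y => (`|g0 y + g1 y| `^ p + `|g0 y - g1 y| `^ p) / 2) x.
  rewrite -cond_expect_flip mulrDl mulrC [X in _ + X]mulrC -lin.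
  congr (cond_expect J _ x); apply/funext => y.
  have -> : g0 y + g1 y = g y by rewrite /g0 /g1 /even_part /discrete_deriv; field.
  have -> : g0 y - g1 y = g (flip i y).
    by rewrite /g0 /g1 /even_part /discrete_deriv; field.
  by rewrite -mulrDr mulrC.
have pos := cond_expect_positive J x.
apply: le_trans (_ : _ <= (cond_expect J (fun y => `|g0 y| `^ p) x) `^ (2 / p)
  + (cond_expect J (fun y => `|rho * g1 y| `^ p) x) `^ (2 / p)) _.
  apply: lerD; first exact: IH.
  have -> : (fun y => `|rho * g1 y| `^ p) =
            (fun y => rho `^ p * `|g1 y| `^ p + 0 * `|g1 y| `^ p).
    apply/funext => y.
    by rewrite mul0r addr0 normrM powRM// ger0_norm// ltW.
  rewrite lin mul0r addr0 powRM ?powR_ge0//; last first.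
    by apply: (positive_functional_ge0 pos) => y; exact: powR_ge0.
  rewrite -powRrM [p * _]mulrC divfK ?gt_eqF// powR_mulrn ?(ltW r0)//.
  by rewrite ler_pM2l ?exprn_gt0//; exact: IH.
(* Writing p-th powers as powers p/2 <= 1 of squares makes reverse Minkowski applicable. *)
have sq z : `|z| `^ p = (z ^+ 2) `^ (p / 2).
  rewrite -(real_normK (num_real z)) -powR_mulrn// -powRrM [2 * _]mulrC.
  by rewrite divfK ?pnatr_eq0.
have -> : 2 / p = (p / 2)^-1 by rewrite invf_div.
have h2 : 0 < p / 2 <= 1 by apply/andP; split; lra.
have -> : (fun y => `|g0 y| `^ p) = (fun y => (g0 y ^+ 2) `^ (p / 2)).
  by apply/funext => y; rewrite sq.
have -> : (fun y => `|rho * g1 y| `^ p) =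
          (fun y => ((rho * g1 y) ^+ 2) `^ (p / 2)).
  by apply/funext => y; rewrite sq.
apply: le_trans (reverse_Minkowski pos h2 _ _) _.
- by move=> y; exact: sqr_ge0.
- by move=> y; exact: sqr_ge0.
apply: ge0_ler_powR.
- by rewrite invr_ge0; lra.
- by rewrite nnegrE; apply: (positive_functional_ge0 pos) => y; exact: powR_ge0.
- rewrite nnegrE; apply: (positive_functional_ge0 pos) => y.
  by rewrite divr_ge0 ?addr_ge0 ?powR_ge0.
apply: mono => y; rewrite (exprMn _ rho) rE; apply: two_point.
by rewrite p1.
Qed.

End Noise.

(** * Walsh-Fourier analysis *)

Section Fourier.
Variables (R : realType) (n : nat).
Implicit Types (rho : R) (f g : cube n -> R) (J : seq 'I_n) (i : 'I_n) (x : cube n)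
  (S : {set 'I_n}).

Let N : R := #|{: cube n}|%:R.

Let N0 : 0 < N.
Proof. by rewrite /N ltr0n; apply/card_gt0P; exists [ffun=> false]. Qed.

Lemma expect_positive : positive_functional (@expect R n).
Proof.
split=> [a b F G|F G FG]; rewrite /expect.
  by rewrite big_split/= -!mulr_sumr mulrDl !mulrA.
by rewrite ler_pM2r ?invr_gt0//; apply: ler_sum => x _; exact: FG.
Qed.

Lemma expect_cst (c : R) : expect (fun _ : cube n => c) = c.
Proof. by rewrite /expect sumr_const -(mulr_natr c) mulfK ?gt_eqF. Qed.

Lemma expect_flip i g : expect (fun x => g (flip i x)) = expect g.
Proof.
by rewrite /expect [in RHS](reindex_inj (inv_inj (flipK i))).
Qed.

Lemma expect_cond_expect J g : expect (cond_expect J g) = expect g.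
Proof.
elim: J g => //= i J IH g; have [lin _] := expect_positive.
rewrite -[LHS](_ : expect (fun x => 2^-1 * cond_expect J g x +
    2^-1 * cond_expect J g (flip i x)) = _).
  by rewrite lin (expect_flip i (cond_expect J g)) IH; field.
by congr expect; apply/funext => x; rewrite -mulrDr mulrC.
Qed.

Lemma cond_expect_invariant J g i x : i \in J ->
  cond_expect J g (flip i x) = cond_expect J g x.
Proof.
elim: J x => //= j J IH x; rewrite inE => /predU1P[->|iJ].
  by rewrite flipK addrC.
by rewrite -flipC !IH.
Qed.

Lemma cond_expect_full g x : cond_expect (enum 'I_n) g x = expect g.
Proof.
rewrite -(expect_cond_expect (enum 'I_n)) -[LHS]expect_cst; congr expect.
apply/funext => y; apply: flip_invariant_constant => i z.
by rewrite cond_expect_invariant ?mem_enum.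
Qed.

Definition fourier g S := expect (fun x => g x * walsh R S x).

Lemma walsh_flip S i x :
  walsh R S (flip i x) = (if i \in S then -1 else 1) * walsh R S x.
Proof.
have E j : cube_coord R (flip i x) j =
    (if j == i then -1 else 1) * cube_coord R x j.
  rewrite /cube_coord ffunE; case: eqP => _; last by rewrite mul1r.
  by case: (x j); rewrite ?expr0 ?expr1 ?mulr1 ?mulrNN ?mul1r.
rewrite /walsh (eq_bigr _ (fun j _ => E j)) big_split/=; congr (_ * _).
case: ifP => iS.
  rewrite (bigD1 i)//= eqxx big1 ?mulr1// => j /andP[_ /negPf ->//].
by apply: big1 => j jS; case: eqP => // ji; rewrite ji iS in jS.
Qed.

(** The sum is the expansion of the product of the factors x_i y_i + 1. A coordinate where [x] and
    [y] differ gives the factor 0; if x = y, every factor is 2. *)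
Lemma walsh_kernel x y :
  \sum_(S : {set 'I_n}) walsh R S x * walsh R S y = if x == y then N else 0.
Proof.
have coord2 (z : cube n) i : cube_coord R z i * cube_coord R z i = 1.
  by rewrite /cube_coord -expr2 sqrr_sign.
transitivity (\prod_i (cube_coord R x i * cube_coord R y i + 1)).
  rewrite bigA_distr; apply: eq_big => S; first by rewrite inE.
  by move=> _; rewrite -big_split/= big_mkcond.
case: eqP => [->|/eqP xy].
  under eq_bigr do rewrite coord2.
  by rewrite prodr_const card_ord /N card_ffun card_bool card_ord natrX.
have [i xyi] : exists i, x i != y i.
  apply/existsP; apply: contraNT xy => /existsPn h.
  by apply/eqP/ffunP => i; apply/eqP; have := h i; rewrite negbK.
rewrite (bigD1 i)//= (_ : _ + 1 = 0) ?mul0r// /cube_coord.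
by case: (x i) (y i) xyi => [] []//= _; rewrite expr0 expr1 ?mulr1 ?mul1r addNr.
Qed.

Lemma Parseval g : expect (fun x => g x ^+ 2) = \sum_S fourier g S ^+ 2.
Proof.
transitivity (\sum_S \sum_x \sum_y
    (g x * g y / N ^+ 2) * (walsh R S x * walsh R S y)).
  rewrite exchange_big/= /expect mulr_suml; apply: eq_bigr => x _.
  rewrite exchange_big/=.
  under eq_bigr do rewrite -mulr_sumr walsh_kernel.
  rewrite (bigD1 x)//= eqxx big1 ?addr0.
    by rewrite -/N; field; rewrite gt_eqF.
  by move=> y /negPf yx; rewrite eq_sym yx mulr0.
apply: eq_bigr => S _; rewrite /fourier /expect -/N.
have sq (a : R) : (a / N) ^+ 2 = a * a / N ^+ 2 by rewrite exprMn exprVn.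
rewrite sq big_distrlr/= mulr_suml; apply: eq_bigr => x _.
by rewrite mulr_suml; apply: eq_bigr => y _; ring.
Qed.

Lemma fourier_lin a b F G S :
  fourier (fun x => a * F x + b * G x) S = a * fourier F S + b * fourier G S.
Proof.
have [lin _] := expect_positive.
by rewrite /fourier -lin; congr expect; apply/funext => x; ring.
Qed.

Lemma fourier_flip i g S :
  fourier (fun x => g (flip i x)) S = (if i \in S then -1 else 1) * fourier g S.
Proof.
have [lin _] := expect_positive.
rewrite /fourier -(expect_flip i) -[RHS]addr0 -[X in _ + X](mul0r (expect g)) -lin.
by congr expect; apply/funext => x; rewrite flipK walsh_flip; ring.
Qed.

Lemma fourier_deriv i g S :
  fourier (discrete_deriv i g) S = if i \in S then fourier g S else 0.
Proof.
rewrite -[LHS](_ : fourier (fun x => 2^-1 * g x + (- 2^-1) * g (flip i x)) S = _).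
  by rewrite fourier_lin fourier_flip; case: ifP => _; field.
by congr fourier; apply/funext => x; rewrite /discrete_deriv; ring.
Qed.

Lemma fourier_noise1 rho i g S :
  fourier (noise1 rho i g) S = (if i \in S then rho else 1) * fourier g S.
Proof.
rewrite -[LHS](_ : fourier
  (fun x => (1 + rho) / 2 * g x + (1 - rho) / 2 * g (flip i x)) S = _).
  by rewrite fourier_lin fourier_flip; case: ifP => _; field.
by congr fourier; apply/funext => x; rewrite /noise1 /even_part /discrete_deriv; field.
Qed.

Lemma fourier_noise rho J g S :
  fourier (noise rho J g) S =
  (\prod_(i <- J) (if i \in S then rho else 1)) * fourier g S.
Proof.
elim: J g => [|i J IH] g /=; first by rewrite big_nil mul1r.
by rewrite IH fourier_noise1 big_cons mulrCA mulrA.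
Qed.

(** Noise in all coordinates multiplies the coefficient at [S] by rho^|S|, so by Parseval the left
    side is the squared 2-norm of the noised function. *)
Lemma hypercontractivity rho g : 0 < rho <= 1 ->
  \sum_(S : {set 'I_n}) (rho ^+ 2) ^+ #|S| * fourier g S ^+ 2
    <= expect (fun x => `|g x| `^ (1 + rho ^+ 2)) `^ (2 / (1 + rho ^+ 2)).
Proof.
move=> r01.
have := noise_hypercontractive (enum 'I_n) g [ffun=> false] r01.
rewrite !cond_expect_full Parseval; congr (_ <= _); apply: eq_bigr => S _.
rewrite fourier_noise exprMn exprAC; congr (_ ^+ 2 * _).
by rewrite big_enum/= -big_mkcond/= prodr_const.
Qed.

End Fourier.

(** * Norm ratios and energy *)

Section NormRatio.
Variables (R : realType) (n : nat).
Implicit Types (g : cube n -> R) (p q s t w z : R).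

Definition log_ratio p q g := ln (pnorm p g / pnorm q g).

Lemma expect_norm_gt0 p g : not_identically_zero g ->
  0 < expect (fun x => `|g x| `^ p).
Proof.
move=> /existsP[x gx]; rewrite /expect divr_gt0//; last first.
  by rewrite ltr0n; apply/card_gt0P; exists x.
rewrite (bigD1 x)//= ltr_pwDl ?powR_gt0 ?normr_gt0//.
by apply: sumr_ge0 => y _; exact: powR_ge0.
Qed.

Lemma ln_pnorm p g : p != 0 ->
  p * ln (pnorm p g) = ln (expect (fun x => `|g x| `^ p)).
Proof. by move=> p0; rewrite /pnorm ln_powR mulVKf. Qed.

Lemma log_ratioE p q g : not_identically_zero g ->
  log_ratio p q g = ln (pnorm p g) - ln (pnorm q g).
Proof.
by move=> g0; rewrite /log_ratio ln_div// posrE powR_gt0// expect_norm_gt0.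
Qed.

Lemma expect_sqr g : expect (fun x => g x ^+ 2) = expect (fun x => `|g x| `^ 2).
Proof.
congr expect; apply/funext => x.
by rewrite powR_mulrn// real_normK ?num_real.
Qed.

Lemma expR_2ln_pnorm p g : not_identically_zero g -> p != 0 ->
  expect (fun x => `|g x| `^ p) `^ (2 / p) = expR (2 * ln (pnorm p g)).
Proof.
move=> g0 p0; rewrite -[LHS]lnK ?posrE ?powR_gt0 ?expect_norm_gt0//.
by rewrite ln_powR -ln_pnorm// mulrA divfK.
Qed.

Lemma expR_2ln_pnorm2 g : not_identically_zero g ->
  expR (2 * ln (pnorm 2 g)) = expect (fun x => g x ^+ 2).
Proof.
move=> g0; rewrite ln_pnorm ?pnatr_eq0// expect_sqr lnK// posrE.
exact: expect_norm_gt0.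
Qed.

Lemma pnorm_interpolation g p q1 q2 a : not_identically_zero g ->
  0 <= a <= 1 -> 0 < p -> 0 < q1 -> 0 < q2 -> p = a * q1 + (1 - a) * q2 ->
  p * ln (pnorm p g)
    <= a * (q1 * ln (pnorm q1 g)) + (1 - a) * (q2 * ln (pnorm q2 g)).
Proof.
move=> g0 a01 p0 q10 q20 pE; rewrite !ln_pnorm ?lt0r_neq0//.
by apply: (Lyapunov (@expect_positive R n)) => //;
  rewrite ?lt0r_neq0//; exact: expect_norm_gt0.
Qed.

Lemma log_ratio21_ge0 g : not_identically_zero g -> 0 <= log_ratio 2 1 g.
Proof.
move=> g0; rewrite log_ratioE//.
have a01 : 0 <= (2^-1 : R) <= 1 by apply/andP; split; lra.
(* Cauchy-Schwarz against the constant 1, which is the power with exponent 0 even where [g]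
   vanishes, since 0^0 = 1 here. *)
have pE : (1 : R) = 2^-1 * 2 + (1 - 2^-1) * 0 by field.
have h0 : expect (fun x : cube n => `|g x| `^ 0) = 1.
  rewrite -[RHS](@expect_cst _ n); congr expect; apply/funext => x.
  by rewrite powRr0.
have step (m1 m2 m0 l1 l2 : R) : m0 = 1 -> 1 * l1 = ln m1 -> 2 * l2 = ln m2 ->
    ln m1 <= 2^-1 * ln m2 + (1 - 2^-1) * ln m0 -> 0 <= l2 - l1.
  by move=> -> <- <-; rewrite ln1; lra.
exact: step h0 (ln_pnorm g (oner_neq0 R)) (ln_pnorm g (lt0r_neq0 (ltr0Sn R 1)))
  (Lyapunov (@expect_positive R n) a01 (oner_neq0 R) pE
  (expect_norm_gt0 _ g0) (expect_norm_gt0 _ g0) (expect_norm_gt0 _ g0)).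
Qed.

Lemma log_ratio_1_le g q : not_identically_zero g -> 1 < q <= 2 ->
  (2 - q) / q * log_ratio 2 1 g <= log_ratio 2 q g.
Proof.
move=> g0 /andP[q1 q2]; rewrite !log_ratioE//.
have a01 : 0 <= q - 1 <= 1 by lra.
have q0 : 0 < q by lra.
have qE : q = (q - 1) * 2 + (1 - (q - 1)) * 1 by ring.
have step (l1 l2 lq : R) :
    q * lq <= (q - 1) * (2 * l2) + (1 - (q - 1)) * (1 * l1) ->
    (2 - q) / q * (l2 - l1) <= l2 - lq.
  move=> h; rewrite -(ler_pM2l q0) mulrA [q * (_ / _)]mulrC divfK ?gt_eqF//.
  lra.
exact: step (pnorm_interpolation g0 a01 q0 (ltr0Sn _ 1) ltr01 qE).
Qed.

(** Here w = e^(-t), z = e^(-st), and [l2], [lq], [lp] are the logarithms of the norms with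
    exponents 2, 1 + w, 1 + z. Log-convexity gives (1 + z)(l2 - lp) >= (1 - a)(1 + w)(l2 - lq); then
    1 - a = (1 - z)/(1 - w) >= s and 2(1 + w) >= 1 + z finish. *)
Lemma interpolated_exponent s w z (l2 lq lp : R) (a := (z - w) / (1 - w)) :
  0 < w < 1 -> w <= z <= 1 -> s * (1 - w) <= 1 - z -> 0 <= l2 - lq ->
  (1 + z) * lp <= a * (2 * l2) + (1 - a) * ((1 + w) * lq) ->
  2 * lp <= 2 * l2 - s * (l2 - lq).
Proof.
move=> /andP[w0 w1] /andP[wz z1] sz L0 hp.
have d0 : 0 < 1 - w by lra.
have sa : s <= 1 - a.
  rewrite (_ : 1 - a = (1 - z) / (1 - w)) ?ler_pdivlMr//.
  by rewrite /a; field; rewrite gt_eqF.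
have pE : 1 + z = a * 2 + (1 - a) * (1 + w) by rewrite /a; field; rewrite gt_eqF.
have a1 : 0 <= 1 - a.
  by rewrite subr_ge0 ler_pdivrMr//; lra.
have p0 : 0 < 1 + z by lra.
clearbody a.
have hp' : (1 + z) * lp <= (1 + z) * l2 - (1 - a) * (1 + w) * (l2 - lq).
  by rewrite [X in X * l2]pE; lra.
have h1 : s * (l2 - lq) <= (1 - a) * (l2 - lq) by rewrite ler_wpM2r.
have X0 : 0 <= (1 - a) * (l2 - lq) by rewrite mulr_ge0.
have h2 : (1 + z) * ((1 - a) * (l2 - lq)) <= 2 * ((1 + w) * ((1 - a) * (l2 - lq))).
  by rewrite mulrA ler_wpM2r//; lra.
have h3 : (1 + z) * (s * (l2 - lq)) <= (1 + z) * ((1 - a) * (l2 - lq)).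
  by rewrite ler_pM2l.
by rewrite -(ler_pM2l p0); lra.
Qed.

Lemma hypercontractive_interpolation g s t : not_identically_zero g ->
  0 < t -> 0 <= s <= 1 -> 0 <= log_ratio 2 (1 + expR (- t)) g ->
  \sum_(S : {set 'I_n}) expR (- (s * t)) ^+ #|S| * fourier g S ^+ 2
    <= expect (fun x => g x ^+ 2) *
       expR (- (s * log_ratio 2 (1 + expR (- t)) g)).
Proof.
move=> g0 t0 s01; rewrite log_ratioE//.
have sz := expRN_concave t0 s01; have /andP[s0 s1] := s01.
(* Chosen so that [rho ^+ 2] is e^(-st); the resulting exponent 1 + e^(-st) lies between 1 + e^(-t)
   and 2. *)
pose rho : R := expR (- (s * t / 2)).
have rho01 : 0 < rho <= 1.
  by rewrite expR_gt0 -expR0 ler_expR oppr_le0 divr_ge0// mulr_ge0// ltW.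
have rho2 : rho ^+ 2 = expR (- (s * t)).
  by rewrite -expRM_natl; congr expR; field.
have := hypercontractivity g rho01; rewrite rho2.
have w01 : 0 < expR (- t) < 1.
  by rewrite expR_gt0 -expR0 ltr_expR oppr_lt0.
have wz : expR (- t) <= expR (- (s * t)) <= 1.
  rewrite ler_expR lerN2 ler_piMl ?(ltW t0)//=.
  by rewrite -[leRHS]expR0 ler_expR oppr_le0 mulr_ge0// ltW.
have z0 : 0 < expR (- (s * t)) := expR_gt0 _.
move: (expR (- (s * t))) (expR (- t)) z0 sz w01 wz => z w z0 sz w01 wz h L0.
apply: (le_trans h).
have /andP[w0 w1] := w01; have /andP[wz' z1] := wz.
have p0 : 0 < 1 + z by rewrite addr_gt0.
have q0 : 0 < 1 + w by rewrite addr_gt0.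
pose a := (z - w) / (1 - w).
have d0 : 0 < 1 - w by rewrite subr_gt0.
have a01 : 0 <= a <= 1.
  by rewrite divr_ge0 ?subr_ge0 ?(ltW w1)//= ler_pdivrMr// mul1r lerD2r.
have pE : 1 + z = a * 2 + (1 - a) * (1 + w) by rewrite /a; field; rewrite gt_eqF.
rewrite (expR_2ln_pnorm g0 (lt0r_neq0 p0)) -(expR_2ln_pnorm2 g0) -expRD ler_expR.
exact: interpolated_exponent w01 wz sz L0
  (pnorm_interpolation g0 a01 p0 (ltr0Sn _ 1) q0 pE).
Qed.

End NormRatio.

(** * Energy of the derivatives and comparison of the weights *)

Section Energy.
Variables (R : realType) (n k : nat) (k_gt0 : (0 < k)%N).
Implicit Types (f g : cube n -> R) (S : {set 'I_n}).

(* If [E g = 0], this is [2 \int_0^{1/k} E (T_t g)^2 dt]; the term [S = set0]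
   is [0], because [x / 0 = 0]. *)
Definition energy g : R :=
  \sum_(S : {set 'I_n})
     (1 - expR (- (2 / k%:R) * #|S|%:R)) / #|S|%:R * fourier g S ^+ 2.

Let T : R := k%:R^-1.

Let T0 : 0 < T. Proof. by rewrite invr_gt0 ltr0n. Qed.

(** The coefficient at [S] occurs in exactly |S| of the derivatives, which cancels the division by
    |S|. Only |S| >= k contributes, and there 1 - e^(-2|S|/k) >= 1 - e^(-2). *)
Lemma energy_ge f :
  (forall S, (#|S| < k)%N -> fourier f S = 0) ->
  (1 - expR (-2)) * expect (fun x => f x ^+ 2)
    <= \sum_i energy (discrete_deriv i f).
Proof.
move=> hf; rewrite exchange_big/= Parseval mulr_sumr; apply: ler_sum => S _.
have [Sk|kS] := ltnP #|S| k.
  rewrite hf// expr0n/= mulr0 sumr_ge0// => i _.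
  by rewrite fourier_deriv hf// if_same expr0n/= mulr0.
under eq_bigr do rewrite fourier_deriv (fun_if (fun a => a ^+ 2)) expr0n/=.
have s0 : 0 < #|S|%:R :> R by rewrite ltr0n (leq_trans k_gt0).
rewrite -mulr_sumr -big_mkcond/= sumr_const -(mulr_natr (_ ^+ 2)).
rewrite [X in _ <= X](_ : _ =
  (1 - expR (- (2 / k%:R) * #|S|%:R)) * fourier f S ^+ 2).
  rewrite ler_wpM2r ?sqr_ge0// lerD2l lerN2 ler_expR mulNr lerN2 -mulrA.
  by rewrite ler_peMr// mulrC ler_pdivlMr ?ltr0n// mul1r ler_nat.
by field; rewrite gt_eqF.
Qed.

(** A left Riemann sum dominates the integral of a decreasing function. For each nonempty [S] this
    is 1 - y^m = (1 - y)(1 + y + ... + y^(m-1)) together with 1 - y <= 2T|S|/m. *)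
Lemma energy_riemann g m : (0 < m)%N ->
  energy g <= 2 * T / m%:R *
    \sum_(j < m) \sum_(S : {set 'I_n})
       expR (- (j%:R / m%:R * (2 * T))) ^+ #|S| * fourier g S ^+ 2.
Proof.
move=> m0; have m0' : 0 < m%:R :> R by rewrite ltr0n.
rewrite exchange_big/= mulr_sumr; apply: ler_sum => S _.
rewrite -mulr_suml mulrA ler_wpM2r ?sqr_ge0//.
have [s0|s0] := posnP #|S|.
  by rewrite s0 invr0 mulr0 mulr_ge0 ?divr_ge0 ?mulr_ge0 ?(ltW T0)//
    sumr_ge0// => j _; rewrite expr0.
rewrite ler_pdivrMr ?ltr0n//.
pose y := expR (- (2 * T / m%:R * #|S|%:R)).
have yE j : expR (- (j%:R / m%:R * (2 * T))) ^+ #|S| = y ^+ j.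
  by rewrite -!expRM_natl; congr expR; field; rewrite gt_eqF.
under eq_bigr do rewrite yE.
have -> : expR (- (2 / k%:R) * #|S|%:R) = y ^+ m.
  rewrite -expRM_natl; congr expR; rewrite /T; field.
  by rewrite !gt_eqF ?ltr0n.
have := subrX1 y m => yX.
rewrite -opprB yX -mulNr opprB mulrAC.
apply: ler_wpM2r; first by apply: sumr_ge0 => j _; rewrite exprn_ge0// expR_ge0.
by have := expR_ge1Dx (- (2 * T / m%:R * #|S|%:R)); rewrite -/y; lra.
Qed.

Lemma energy_le g : not_identically_zero g ->
  energy g <= 5 / 2 * T *
    (expect (fun x => g x ^+ 2)
       / Num.max 1 (log_ratio 2 (1 + expR (- (2 / k%:R))) g)).
Proof.
move=> g0; set L := log_ratio _ _ _; set M := expect _.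
have M0 : 0 < M by rewrite /M expect_sqr expect_norm_gt0.
have TM0 : 0 < T * M by rewrite mulr_gt0.
have [L1|L1] := leP L 1.
  (* For L <= 1 a single step suffices: it gives 2TM. *)
  have := energy_riemann g (ltn0Sn 0).
  rewrite big_ord1 (eq_bigr (fun S => fourier g S ^+ 2)) => [|S _].
    by rewrite -Parseval -/M !divr1; nra.
  by rewrite /= !mul0r oppr0 expR0 expr1n mul1r.
have L0 : 0 < L by lra.
(* The geometric sum with ratio e^(-L/m) is at most 1 + m/L, so the energy is at most 2TM(1/m +
   1/L). Taking m >= 4L turns the constant into 2(1/4 + 1) = 5/2. *)
pose m := (Num.trunc (4 * L)).+1.
have mL : 4 * L <= m%:R by apply/ltW/truncnS_gt.
have m0 : 0 < m%:R :> R by rewrite ltr0n.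
apply: le_trans (energy_riemann g (ltn0Sn _ : (0 < m)%N)) _.
pose w := expR (- (L / m%:R)).
have w0 : 0 < w := expR_gt0 _.
have y0 : 0 < L / m%:R by rewrite divr_gt0.
have w1 : w * (1 + L / m%:R) <= 1.
  have := expR_ge1Dx (L / m%:R); rewrite -(ler_pM2l w0) => /le_trans; apply.
  by rewrite -expRD addNr expR0.
have H : \sum_(j < m) \sum_(S : {set 'I_n})
      expR (- (j%:R / m%:R * (2 * T))) ^+ #|S| * fourier g S ^+ 2
    <= M * \sum_(j < m) w ^+ j.
  rewrite mulr_sumr; apply: ler_sum => j _.
  have jm : 0 <= (j%:R / m%:R : R) <= 1.
    by rewrite divr_ge0//= ler_pdivrMr// mul1r ler_nat ltnW.
  have t0 : 0 < 2 * T by rewrite mulr_gt0.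
  have := hypercontractive_interpolation g0 t0 jm (ltW L0).
  rewrite -/L -/M => /le_trans; apply; rewrite le_eqVlt; apply/orP; left.
  apply/eqP; congr (_ * _); rewrite -expRM_natl; congr expR.
  by field; rewrite gt_eqF.
have G : \sum_(j < m) w ^+ j <= 1 + m%:R / L.
  have := subrX1 w m; have : 0 <= w ^+ m by rewrite exprn_ge0// ltW.
  have : 0 <= \sum_(j < m) w ^+ j.
    by apply: sumr_ge0 => j _; rewrite exprn_ge0// ltW.
  move: (\sum_(j < m) w ^+ j) (w ^+ m) => s wm s0 wm0 wE.
  have : s * (L / m%:R) <= 1 + L / m%:R by nra.
  rewrite -ler_pdivlMr// => /le_trans; apply.
  by rewrite le_eqVlt; apply/orP; left; apply/eqP; field; rewrite !gt_eqF.
have Tm : 0 <= 2 * T / m%:R by rewrite divr_ge0 ?mulr_ge0// ltW.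
apply: le_trans (ler_wpM2l Tm H) _.
apply: le_trans (ler_wpM2l Tm (ler_wpM2l (ltW M0) G)) _.
have -> : 2 * T / m%:R * (M * (1 + m%:R / L)) = 2 * (T * M) * (m%:R^-1 + L^-1).
  by field; rewrite !gt_eqF.
have -> : 5 / 2 * T * (M / L) = 2 * (T * M) * ((4 * L)^-1 + L^-1).
  by field; rewrite !gt_eqF.
have TM2 : 0 < 2 * (T * M) by rewrite mulr_gt0.
by rewrite (ler_pM2l TM2) lerD2r lef_pV2 ?posrE// mulr_gt0.
Qed.

Lemma energy0 g : ~~ not_identically_zero g -> energy g = 0.
Proof.
move=> /existsPn g0; apply: big1 => S _.
rewrite (_ : fourier g S = 0) ?expr0n ?mulr0//.
rewrite -[RHS](@expect_cst R n); congr expect; apply/funext => x.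
by have /negPn/eqP -> := g0 x; rewrite mul0r.
Qed.

(** The right side is tanh T with T = 1/k <= 1. The fourth power of e^(T/2) >= 1 + T/2 gives e^(2T)
    >= 1 + 2T + 3T^2/2, which is at least (1 + 3T/5)/(1 - 3T/5). *)
Lemma expR_scaled_tanh_ge :
  3 / 5 * T <= (1 - expR (- (2 / k%:R))) / (1 + expR (- (2 / k%:R))).
Proof.
have T1 : T <= 1 by rewrite invf_le1 ?ltr0n// ler1n.
rewrite -/T; set e := expR _.
have e0 : 0 < e := expR_gt0 _.
rewrite ler_pdivlMr; last lra.
have h : 1 + T / 2 <= expR (T / 2) := expR_ge1Dx _.
have eV : expR (T / 2) ^+ 4 * e = 1.
  by rewrite -expRM_natl -expRD -[RHS]expR0; congr expR; rewrite -/T; field.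
have h4 : (1 + T / 2) ^+ 4 <= expR (T / 2) ^+ 4.
  by rewrite lerXn2r ?nnegrE//; have := T0; lra.
have h5 : 1 + 2 * T + 3 / 2 * T ^+ 2 <= (1 + T / 2) ^+ 4.
  have : 0 <= T ^+ 3 by rewrite exprn_ge0 ?ltW.
  have : 0 <= T ^+ 4 by rewrite exprn_ge0 ?ltW.
  nra.
have h6 : (1 + 2 * T + 3 / 2 * T ^+ 2) * e <= 1.
  by rewrite -[leRHS]eV ler_pM2r// (le_trans h5).
have h7 : (1 + 3 / 5 * T) <= (1 + 2 * T + 3 / 2 * T ^+ 2) * (1 - 3 / 5 * T).
  by have := T0; nra.
have h8 := ler_wpM2r (ltW e0) h7.
have h9 :
    (1 - 3 / 5 * T) * ((1 + 2 * T + 3 / 2 * T ^+ 2) * e) <= 1 - 3 / 5 * T.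
  by rewrite ler_piMr//; lra.
lra.
Qed.

(** The claim amounts to 3K + 3x <= 8KM. It follows from 3K <= 3KM and 3x <= 5KM, whence the
    constant 8. *)
Lemma weight_comparison (K x y M : R) : 0 < K -> 0 <= x ->
  3 / 5 * K^-1 * x <= y -> 1 <= M -> y <= M -> 3 / K * M^-1 <= 8 * (K + x)^-1.
Proof.
move=> K0 x0 xy M1 yM.
have M0 : 0 < M by lra.
have Kx0 : 0 < K + x by lra.
rewrite -mulrA -invfM ler_pdivlMr// mulrAC ler_pdivrMr ?mulr_gt0//.
have xM : 3 / 5 * x <= K * M.
  have := ler_wpM2l (ltW K0) (le_trans xy yM).
  by rewrite mulrA [K * (_ * _)]mulrCA divff ?gt_eqF// mulr1.
have KM : K <= K * M by rewrite ler_peMr// ltW.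
lra.
Qed.

Lemma weight_le g : not_identically_zero g ->
  3 / k%:R * (Num.max 1 (log_ratio 2 (1 + expR (- (2 / k%:R))) g))^-1
    <= 8 * (k%:R + log_ratio 2 1 g)^-1.
Proof.
move=> g0; have K0 : 0 < k%:R :> R by rewrite ltr0n.
have e0 : 0 < expR (- (2 / k%:R)) :> R := expR_gt0 _.
have e1 : expR (- (2 / k%:R)) <= 1 :> R.
  by rewrite -[leRHS]expR0 ler_expR oppr_le0 divr_ge0.
have q12 : 1 < (1 + expR (- (2 / k%:R)) : R) <= 2 by lra.
have qE : 2 - (1 + expR (- (2 / k%:R))) = 1 - expR (- (2 / k%:R)) :> R by ring.
have L1_ge0 := log_ratio21_ge0 g0.
have := log_ratio_1_le g0 q12; rewrite qE => hL.
apply: (weight_comparison K0 L1_ge0 (le_trans _ hL)).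
- exact: (ler_wpM2r L1_ge0 expR_scaled_tanh_ge).
- by rewrite le_max lexx.
- by rewrite le_max lexx orbT.
Qed.

End Energy.

(** * Numerical constant and conclusion *)

Lemma expRN2_le (R : realType) : expR (-2) <= 1 / 6 :> R.
Proof.
have h : 1 + 8^-1 <= expR (8^-1 : R) := expR_ge1Dx _.
have e16 : expR (8^-1 : R) ^+ 16 * expR (-2) = 1.
  by rewrite -expRM_natl -expRD -[RHS]expR0; congr expR; field.
have h16 : (6 : R) <= expR (8^-1 : R) ^+ 16.
  apply: le_trans (_ : (1 + 8^-1) ^+ 16 <= _); first lra.
  by rewrite lerXn2r ?nnegrE ?expR_ge0//; lra.
have := expR_gt0 (-2 : R) => e0.
have := ler_wpM2r (ltW e0) h16; lra.
Qed.

Theorem theorem1p16 (R : realType) (n k : nat) (hn : (1 <= n)%N)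
    (hk : (1 <= k)%N) (f : cube n -> R)
    (hf : forall S : {set 'I_n}, (#|S| < k)%N ->
      expect (fun x => f x * walsh R S x) = 0) :
  expect (fun x => f x ^+ 2)
    <= 3 / k%:R *
       \sum_(i < n | not_identically_zero (discrete_deriv i f))
          expect (fun x => discrete_deriv i f x ^+ 2) /
          Num.max 1 (ln (pnorm 2 (discrete_deriv i f) /
                         pnorm (1 + expR (- (2 / k%:R))) (discrete_deriv i f)))
    <= 8 *
       \sum_(i < n | not_identically_zero (discrete_deriv i f))
          expect (fun x => discrete_deriv i f x ^+ 2) /
          (k%:R + ln (pnorm 2 (discrete_deriv i f) /
                      pnorm 1 (discrete_deriv i f))).
Proof.
apply/andP; split.
  have := energy_ge hk hf.
  rewrite (bigID (fun i => not_identically_zero (discrete_deriv i f)))/=.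
  rewrite [X in _ <= _ + X]big1 ?addr0; last by move=> i; exact: energy0.
  set E := expect _ => hE.
  have E0 : 0 <= E.
    apply: (positive_functional_ge0 (@expect_positive R n)) => x.
    exact: sqr_ge0.
  set Sum := \sum_(i < n | _) (_ / _).
  have hS : \sum_(i < n | not_identically_zero (discrete_deriv i f))
      energy k (discrete_deriv i f) <= 5 / 2 * k%:R^-1 * Sum.
    by rewrite /Sum mulr_sumr; apply: ler_sum => i; exact: energy_le.
  (* Since 1 - e^(-2) >= 5/6, the constant becomes (5/2)/(5/6) = 3. *)
  have := le_trans hE hS; have := ler_wpM2r E0 (expRN2_le R).
  move: (expR (-2)) k%:R^-1 => e T h h'; lra.
(* The second inequality holds term by term. *)
rewrite !mulr_sumr; apply: ler_sum => i gi.
rewrite mulrCA [8 * _]mulrCA ler_wpM2l//; last exact: weight_le.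
by apply: (positive_functional_ge0 (@expect_positive R n)) => x; exact: sqr_ge0.
Qed.
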